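(* There is no finite non-nilpotent group $G$ having a non-nilpotent proper subgroup $H<G$ such that the graphs $\mathfrak{N}_G$ and $\mathfrak{N}_H$ are isomorphic.
   Context: For a group $G$, $nil(G)=\{x\in G \mid \langle x,y\rangle \text{ is nilpotent for all } y\in G\}$. The graph $\mathfrak{N}_G$ is the simple graph with vertex set $G\setminus nil(G)$ in which two distinct vertices $x,y$ are adjacent if and only if $\langle x,y\rangle$ is not nilpotent. *)

(* Defs.v *)
From mathcomp Require Import all_boot all_fingroup all_solvable.

Set Implicit Arguments.
Unset Strict Implicit.
Unset Printing Implicit Defensive.

Local Open Scope group_scope.

Record sgraph := SGraph {
  vertex : finType;
  adj : rel vertex;
  adj_sym : symmetric adj;
  adj_irrefl : irreflexive adj
}.

Definition graph_iso (X Y : sgraph) : Prop :=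
  exists2 f : vertex X -> vertex Y,
    bijective f & forall x y : vertex X, adj (f x) (f y) = adj x y.

Section NonNilpotentGraph.

Variables (gT : finGroupType) (G : {group gT}).

Definition nil_set : {set gT} :=
  [set x in G | [forall y in G, nilpotent <<[set x; y]>>]].

Definition nng_vertex : finType := {x : gT | x \in G :\: nil_set}.

Definition nng_adj : rel nng_vertex :=
  [rel x y | (x != y) && ~~ nilpotent <<[set val x; val y]>>].

Lemma nng_adj_sym : symmetric nng_adj.
Proof. by move=> x y; rewrite /nng_adj /= eq_sym setUC. Qed.

Lemma nng_adj_irrefl : irreflexive nng_adj.
Proof. by move=> x; rewrite /nng_adj /= eqxx. Qed.

Definition non_nilpotent_graph : sgraph := SGraph nng_adj_sym nng_adj_irrefl.

End NonNilpotentGraph.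

(* Main.v *)
(** Counting vertices suffices. Every element of [nil(G)] lies in the Fitting
    subgroup: if [x] is in [nil(G)] then each primary constituent of [x] lies,
    with all its conjugates by [y], in the Sylow subgroup of the nilpotent group
    [<x, y>], so the Baer-Suzuki theorem puts it in ['O_p(G)]. When [G] is not
    nilpotent, ['F(G)] has index at least 2, hence the graph of [G] has at least
    [|G| / 2 >= |H|] vertices, while that of [H] has fewer than [|H|], as [1] is
    not a vertex. *)

Require Import Defs.
From mathcomp Require Import all_boot all_fingroup all_solvable.

Local Open Scope group_scope.

Lemma nil_set_sub_Fitting (gT : finGroupType) (G : {group gT}) :
  nil_set G \subset 'F(G).
Proof.
apply/subsetP => x; rewrite inE => /andP[Gx /forall_inP nilx].
rewrite -(prod_constt x); apply: group_prod => p _.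
have OpF : 'O_p(G) \subset 'F(G).
  by rewrite Fitting_max ?pcore_normal ?(pgroup_nil (pcore_pgroup p G)).
apply: (subsetP OpF); apply: Baer_Suzuki.
  exact: groupX.
move=> y Gy; set K := <<[set x; y]>>.
have nilK : nilpotent K by apply: nilx.
have Kx : x \in K by rewrite mem_gen // set21.
have Ky : y \in K by rewrite mem_gen // set22.
have Opx : x.`_p \in 'O_p(K).
  by rewrite (mem_normal_Hall (nilpotent_pcore_Hall p nilK) (pcore_normal _ _))
    ?p_elt_constt ?groupX.
(* As [y] lies in [K], it normalizes ['O_p(K)], so this [p]-group contains the [p]-constituent of
   [x] together with its conjugate by [y]. *)
apply: pgroupS (pcore_pgroup p K).
rewrite gen_subG subUset !sub1set Opx memJ_norm //.
exact: subsetP (gFnorm _ _) y Ky.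
Qed.

Lemma one_in_nil_set (gT : finGroupType) (G : {group gT}) : 1 \in nil_set G.
Proof.
rewrite inE group1; apply/forall_inP => y _; apply: abelian_nil.
rewrite abelian_gen; apply: abelianS (cycle_abelian y).
by rewrite subUset !sub1set group1 cycle_id.
Qed.

Lemma double_card_proper (gT : finGroupType) (G H : {group gT}) :
  H \proper G -> (#|H|.*2 <= #|G|)%N.
Proof.
move=> prHG; rewrite -(Lagrange (proper_sub prHG)) -muln2 leq_mul2l.
by rewrite indexg_gt1 proper_subn ?orbT.
Qed.

Lemma card_nng_vertex (gT : finGroupType) (G : {group gT}) :
  #|nng_vertex G| = (#|G| - #|nil_set G|)%N.
Proof.
rewrite card_sig -cardsDS; first by apply: eq_card => x; rewrite !inE.
by apply/subsetP => x /[!inE] /andP[].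
Qed.

Theorem proposition4p9 (gT : finGroupType) (G H : {group gT})
    (nnilG : ~~ nilpotent G) (nnilH : ~~ nilpotent H) (prHG : H \proper G) :
  ~ graph_iso (non_nilpotent_graph G) (non_nilpotent_graph H).
Proof.
case=> f bijf _; have := bij_eq_card bijf.
rewrite [LHS]card_nng_vertex [RHS]card_nng_vertex => eqGH.
have prF : 'F(G) \proper G.
  rewrite properEneq Fitting_sub andbT; apply: contraNneq nnilG => <-.
  exact: Fitting_nil.
have leH := double_card_proper _ _ _ prHG.
have leF := double_card_proper _ _ _ prF.
have leN := subset_leq_card (nil_set_sub_Fitting _ G).
have ltH : (#|H| - #|nil_set H| < #|H|)%N.
  (* The inequality is strict only because [nil_set H] is nonempty. *)
  rewrite ltn_subrL cardG_gt0 andbT.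
  by apply/card_gt0P; exists 1; apply: one_in_nil_set.
have : (#|H| <= #|G| - #|nil_set G|)%N.
  rewrite leq_subRL; last by rewrite (leq_trans leN) ?subset_leq_card ?Fitting_sub.
  (* Doubling avoids halving [#|G|]: it remains to add [2|nil(G)| <= 2|F(G)| <= |G|] and
     [2|H| <= |G|]. *)
  rewrite -leq_double doubleD -[X in (_ <= X)%N]addnn leq_add //.
  by apply: leq_trans leF; rewrite leq_double.
by rewrite eqGH leqNgt ltH.
Qed.
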